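(* Let $k$ be a fixed positive integer and let $\varepsilon>0$ be a fixed real number. For each $n$, let $D\subseteq\{1,2,\ldots,n\}$ be a $k$-element subset chosen uniformly at random. Then the probability that $\kappa(D)\geqslant \frac{1}{2}-\varepsilon$ tends to $1$ as $n\to\infty$.
   Context: For a real number $x$, $\|x\|$ denotes the distance from $x$ to the nearest integer. $\mathbb{T}=[0,1)$ is the circle. For a finite set $D=\{d_1,\ldots,d_k\}$ of positive integers, $\kappa(D)=\sup_{x\in\mathbb{T}}\min_{d_i\in D}\|x d_i\|$. *)

(* Defs.v *)
From HB Require Import structures.
From mathcomp Require Import all_boot all_order all_algebra finmap.
From mathcomp Require Import all_classical all_reals all_analysis.

Set Implicit Arguments.
Unset Strict Implicit.
Unset Printing Implicit Defensive.

Import Order.TTheory GRing.Theory Num.Theory.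
Import numFieldNormedType.Exports.

Local Open Scope classical_set_scope.
Local Open Scope fset_scope.
Local Open Scope ring_scope.

Definition dist_int (R : realType) (x : R) : R :=
  inf [set `|x - m%:~R| | m in [set: int]].

(* The neutral element 1/2 is an upper bound of dist_int, so for a nonempty D
   the iterated minimum is the minimum over D. *)
Definition min_dist (R : realType) (D : {fset nat}) (x : R) : R :=
  \big[Num.min/2^-1]_(d <- D) dist_int (x * d%:R).

Definition kappa (R : realType) (D : {fset nat}) : R :=
  sup [set min_dist D x | x in `[0, 1[%classic].

Definition ksubsets (n k : nat) : {fset {fset nat}} :=
  [fset D in fpowerset [fset d in iota 1 n] | #|` D| == k].

(* The value is 0 when S is empty. *)
Definition unif_prob (R : realType) (T : choiceType) (S : {fset T})
    (P : T -> Prop) : R :=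
  #|` [fset s in S | `[< P s >]]|%:R / #|` S|%:R.

(* Main.v *)
Require Import Defs.
From mathcomp Require Import all_boot all_order all_algebra finmap.
From mathcomp Require Import all_classical all_reals all_analysis.
From mathcomp Require Import zify ring lra.
Import Order.TTheory GRing.Theory Num.Theory.
Import numFieldNormedType.Exports.
Local Open Scope classical_set_scope.
Local Open Scope ring_scope.

(** If no nontrivial relation [\sum_(d in D) a_d d = 0] with [|a_d| <= M] holds,
    the angles [d t], [d \in D], are independent on average as far as
    trigonometric polynomials of degree at most [M] are concerned. Weight the
    points [t = 2 pi j / N] ([N] large) by [W t = \prod_d F_M (d t)], where [F_M]
    is the nonnegative Fejér kernel concentrated at [pi]. Then the weighted mean
    of [1 + cos (d t)] is [1 / M], so some [t] satisfies
    [\sum_d (1 + cos (d t)) <= k / M], and every [d t] is close to [pi], that is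
    [d t / (2 pi)] is close to [1/2] modulo 1.
    If [D] does satisfy such a relation, one element of [D] is determined by the
    others and the coefficients, up to boundedly many choices; hence there are at
    most [K 'C(n, k - 1)] such sets, a fraction [O(1/n)] of all [k]-subsets. *)

(** * Fejér weights and averages over the N-th roots of unity *)

Section Fejer.
Variable R : realType.
Implicit Types (t x : R) (M N d : nat) (b : int).

(** This is |sum_{j<M} (-e^{it})^j|^2, that is [M] times the usual Fejér kernel at t + pi, written
    as a sum of two real squares. *)
Definition fejer M t : R :=
  (\sum_(j < M) (-1) ^+ j * cos (j%:R * t)) ^+ 2 +
  (\sum_(j < M) (-1) ^+ j * sin (j%:R * t)) ^+ 2.

Lemma fejer_ge0 M t : 0 <= fejer M t.
Proof. by rewrite addr_ge0 ?sqr_ge0. Qed.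

Lemma fejerE M t : fejer M t =
  \sum_(p < M) \sum_(q < M)
    (-1) ^+ p * (-1) ^+ q * cos ((p%:Z - q%:Z)%:~R * t).
Proof.
rewrite /fejer !expr2 !mulr_suml -big_split; apply: eq_bigr => p _ /=.
rewrite !mulr_sumr -big_split; apply: eq_bigr => q _ /=.
by rewrite intrB mulrBl cosB; ring.
Qed.

Lemma mulr_cos x y : cos x * cos y = (cos (x + y) + cos (x - y)) / 2 :> R.
Proof. by rewrite cosD cosB; field. Qed.

(** One kernel factor only shifts the frequency [b] by multiples of [d]. With [G] the product of the
    other factors, this peels the factors off one at a time. *)
Lemma sum_cos_fejer (I : finType) (th G : I -> R) b d M :
  \sum_i cos (b%:~R * th i) * (fejer M (d%:R * th i) * G i) =
  \sum_(p < M) \sum_(q < M) (-1) ^+ p * (-1) ^+ q *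
    ((\sum_i cos ((b + (p%:Z - q%:Z) * d%:Z)%:~R * th i) * G i +
      \sum_i cos ((b - (p%:Z - q%:Z) * d%:Z)%:~R * th i) * G i) / 2).
Proof.
under eq_bigr => i _.
  rewrite fejerE mulr_suml mulr_sumr.
  under eq_bigr => p _ do rewrite mulr_suml mulr_sumr.
  over.
rewrite exchange_big; apply: eq_bigr => p _ /=.
rewrite exchange_big; apply: eq_bigr => q _ /=.
rewrite -big_split mulr_suml mulr_sumr; apply: eq_bigr => i _ /=.
rewrite -mulrDl [_ * G i / 2]mulrAC.
have -> : (b - (p%:Z - q%:Z) * d%:Z)%:~R * th i =
    b%:~R * th i - (p%:Z - q%:Z)%:~R * (d%:R * th i).
  by rewrite intrB mulrBl intrM -pmulrn mulrA.
have -> : (b + (p%:Z - q%:Z) * d%:Z)%:~R * th i =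
    b%:~R * th i + (p%:Z - q%:Z)%:~R * (d%:R * th i).
  by rewrite intrD mulrDl intrM -pmulrn mulrA.
by rewrite -mulr_cos; ring.
Qed.

Definition angle N (j : nat) : R := pi *+ 2 * (j%:R / N%:R).

Lemma cosDint2pi t b : cos (t + pi *+ 2 * b%:~R) = cos t.
Proof.
have H (n : nat) (s : R) : cos (s + pi *+ 2 * n%:R) = cos s.
  by rewrite mulr_natr; apply: periodicn; exact: cosD2pi.
case: b => n; first exact: H.
by rewrite NegzE -(H n.+1) mulrNz mulrN subrK.
Qed.

Lemma sum_cos_angle N b : ~~ (N%:Z %| b)%Z ->
  \sum_(j < N) cos (b%:~R * angle N j) = 0.
Proof.
case: N => [|N]; first by rewrite big_ord0.
move=> Nb.
have N0 : (N.+1%:R : R) != 0 by rewrite pnatr_eq0.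
set r := `|(b %% N.+1)%Z|%N.
have rE : (b %% N.+1)%Z = r%:Z.
  by rewrite /r gez0_abs // modz_ge0.
have r_gt0 : (0 < r)%N.
  rewrite lt0n; apply: contra Nb => /eqP r0.
  by apply/dvdz_mod0P; rewrite rE r0.
have r_lt : (r < N.+1)%N.
  by rewrite -ltz_nat -rE ltz_pmod.
have cosE (j : nat) : cos (b%:~R * angle N.+1 j) = cos (r%:R * angle N.+1 j).
  rewrite {1}(divz_eq b N.+1) rE -(cosDint2pi (r%:R * _) ((b %/ N.+1)%Z * j)).
  congr cos; rewrite intrD !intrM /angle.
  by rewrite -!pmulrn; field.
(* Half the angular step: s = pi r / (N + 1) lies strictly between 0 and pi, so [sin s] can be
   cancelled at the end. *)
set s := r%:R * (pi *+ 2) / N.+1%:R / 2 : R.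
have s_gt0 : 0 < sin s.
  have -> : s = pi * (r%:R / N.+1%:R) by rewrite /s; field.
  apply: sin_gt0_pi; apply/andP; split.
    by apply: mulr_gt0; [exact: pi_gt0 | rewrite divr_gt0// ltr0n].
  by rewrite gtr_pMr ?pi_gt0// ltr_pdivrMr ?ltr0n// mul1r ltr_nat.
(* Multiplying by [2 sin s] makes the sum telescope. *)
have tele : \sum_(0 <= j < N.+1) 2 * sin s * cos (b%:~R * angle N.+1 j) = 0.
  rewrite (eq_big_nat _ _ (F2 := fun j =>
      sin (s *+ 2 * j.+1%:R - s) - sin (s *+ 2 * j%:R - s))); last first.
    move=> j _; rewrite cosE.
    have -> : r%:R * angle N.+1 j = s *+ 2 * j%:R.
      by rewrite /angle /s; field.
    have -> : s *+ 2 * j.+1%:R - s = s *+ 2 * j%:R + s.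
      by rewrite -natr1; ring.
    by rewrite sinD sinB; ring.
  rewrite telescope_sumr// mulr0 sub0r sinN opprK.
  have -> : s *+ 2 * N.+1%:R - s = - s + pi *+ 2 * r%:R.
    by rewrite /s; field.
  rewrite mulr_natr periodicn; last exact: sinD2pi.
  by rewrite sinN addNr.
move: tele; rewrite big_mkord -mulr_sumr => /eqP.
by rewrite !mulf_eq0 pnatr_eq0 /= gt_eqF //= => /eqP.
Qed.

(** Coefficients are functions on all of [nat], so a relation on [s] is extended to [d] by
    overriding [a] at [d]; uniqueness keeps the tail intact. *)
Lemma sum_update (a : nat -> int) (r : int) d (s : seq nat) : uniq (d :: s) ->
  \sum_(e <- d :: s) (if e == d then r else a e) * e%:Z =
  r * d%:Z + \sum_(e <- s) a e * e%:Z.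
Proof.
rewrite cons_uniq => /andP[ds _]; rewrite big_cons eqxx; congr (_ + _).
by apply: eq_big_seq => e es /=; case: eqP => // ed; rewrite -ed es in ds.
Qed.

(** Expanding the product leaves only frequencies b + sum a_d d with |a_d| < M, none of them
    divisible by [N], so each cosine sum vanishes. *)
Lemma sum_cos_prod_fejer N M (s : seq nat) b : uniq s ->
  (forall a : nat -> int, (forall d, `|a d| <= M%:Z) ->
    ~~ (N%:Z %| b + \sum_(d <- s) a d * d%:Z)%Z) ->
  \sum_(j < N) cos (b%:~R * angle N j) *
    \prod_(d <- s) fejer M (d%:R * angle N j) = 0.
Proof.
elim: s b => [|d s IH] b.
  move=> _ H; rewrite -[RHS](@sum_cos_angle N b).
    by apply: eq_bigr => j _; rewrite big_nil mulr1.
  by have := H (fun=> 0); rewrite big_nil addr0; apply.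
move=> us H; have /andP[_ us'] := us.
have E0 (r : int) : `|r| <= M%:Z ->
    \sum_(j < N) cos ((b + r * d%:Z)%:~R * angle N j) *
      \prod_(d <- s) fejer M (d%:R * angle N j) = 0.
  move=> rM; apply: IH => // a aM; rewrite -addrA -sum_update//.
  by apply: H => e; case: ifP.
under eq_bigr => j _ do rewrite big_cons.
rewrite (@sum_cos_fejer _ (fun j : 'I_N => angle N j)).
apply: big1 => p _; apply: big1 => q _.
by rewrite -mulNr !E0 ?addr0 ?mul0r ?mulr0//;
  have := ltn_ord p; have := ltn_ord q; lia.
Qed.

Lemma sum_sign_diag M :
  \sum_(p < M) \sum_(q < M) (-1) ^+ p * (-1) ^+ q * (q == p)%:R = M%:R :> R.
Proof.
rewrite (eq_bigr (fun=> 1)) ?sumr_const ?card_ord// => p _.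
rewrite (bigD1 p)//= eqxx mulr1 big1 ?addr0 -?expr2 ?sqrr_sign//.
by move=> q /negbTE ->; rewrite mulr0.
Qed.

(** There are [M] pairs of consecutive indices below [M.+1], and the two signs in each are
    opposite. *)
Lemma sum_sign_offdiag M :
  \sum_(p < M.+1) \sum_(q < M.+1)
    (-1) ^+ p * (-1) ^+ q * (q == p.+1 :> nat)%:R = - M%:R :> R.
Proof.
rewrite exchange_big big_ord_recl /= big1 => [|p _]; last by rewrite mulr0.
rewrite add0r (eq_bigr (fun=> -1)) => [|j _].
  by rewrite sumr_const card_ord mulNrn.
rewrite (bigD1 (widen_ord (leqnSn M) j))//= eqxx mulr1 big1 ?addr0.
  by rewrite exprS mulN1r mulrN -expr2 sqrr_sign.
move=> p pj; rewrite /bump /= add1n eqSS.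
have -> : (j == p :> nat) = false; last by rewrite mulr0.
by apply: contraNF pj => /eqP jp; apply/eqP/val_inj; rewrite /= jp.
Qed.

(** The angles 2 pi j / N see frequencies only modulo [N], so a relation is here a divisibility by
    [N]. *)
Definition relation_free_mod N M (s : seq nat) :=
  forall a : nat -> int, (forall d, `|a d| <= M%:Z) ->
  (N%:Z %| \sum_(d <- s) a d * d%:Z)%Z -> {in s, forall d, a d = 0}.

Lemma relation_free_mod_perm N M s1 s2 : perm_eq s1 s2 ->
  relation_free_mod N M s1 -> relation_free_mod N M s2.
Proof.
move=> s12 H a aM; rewrite -(perm_big _ s12) => /H{}H d.
by rewrite -(perm_mem s12); exact: H.
Qed.

Section Cons.
Variables (N M d : nat) (s : seq nat).
Hypotheses (us : uniq (d :: s)) (fr : relation_free_mod N M (d :: s)).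

Lemma relation_free_mod_cons : relation_free_mod N M s.
Proof.
have /andP[ds _] := us.
move=> a aM Na e es.
have ed : e == d = false by apply: contraNF ds => /eqP <-.
have := @fr (fun e => if e == d then 0 else a e) _ _ e.
rewrite ed; apply; last by rewrite inE es orbT.
  by move=> e'; case: ifP.
by rewrite sum_update// mul0r add0r.
Qed.

Let G (j : 'I_N) := \prod_(e <- s) fejer M (e%:R * angle N j).

(** Orthogonality: a frequency r d cancelled modulo [N] by the frequencies of [G] would be a
    relation on [d :: s], which forces r = 0. *)
Lemma sum_cos_cons (r : int) : `|r| <= M%:Z ->
  \sum_(j < N) cos ((r * d%:Z)%:~R * angle N j) * G j =
  (r == 0)%:R * \sum_(j < N) G j.
Proof.
move=> rM; have [->|r0] := eqVneq r 0.
  by rewrite mul1r; apply: eq_bigr => j _; rewrite !mul0r cos0 mul1r.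
have /andP[_ us'] := us.
rewrite mul0r; apply: sum_cos_prod_fejer => // a aM.
apply/negP => Na; apply/negP: r0; rewrite negbK.
have := @fr (fun e => if e == d then r else a e) _ _ d.
rewrite eqxx mem_head => -> //.
  by move=> e'; case: ifP.
by rewrite sum_update.
Qed.

Lemma sum_fejer_cons :
  \sum_(j < N) fejer M (d%:R * angle N j) * G j = M%:R * \sum_(j < N) G j.
Proof.
transitivity (\sum_(j < N) cos (0%:~R * angle N j) *
    (fejer M (d%:R * angle N j) * G j)).
  by apply: eq_bigr => j _; rewrite mul0r cos0 mul1r.
rewrite (@sum_cos_fejer _ (fun j : 'I_N => angle N j)).
rewrite -sum_sign_diag mulr_suml; apply: eq_bigr => p _.
rewrite mulr_suml; apply: eq_bigr => q _.
rewrite add0r sub0r -mulNr !sum_cos_cons; try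
  by have := ltn_ord p; have := ltn_ord q; lia.
rewrite oppr_eq0 subr_eq0 eq_sym (_ : (q%:Z == p) = (q == p))//.
by field.
Qed.

Lemma sum_cos_fejer_cons : (0 < M)%N ->
  \sum_(j < N) (1 + cos (d%:R * angle N j)) *
    (fejer M (d%:R * angle N j) * G j) = \sum_(j < N) G j.
Proof.
move=> M0.
transitivity (\sum_(j < N) fejer M (d%:R * angle N j) * G j +
   \sum_(j < N) cos ((d%:Z)%:~R * angle N j) *
    (fejer M (d%:R * angle N j) * G j)).
  rewrite -big_split; apply: eq_bigr => j _ /=.
  by rewrite mulrDl mul1r -pmulrn.
rewrite sum_fejer_cons (@sum_cos_fejer _ (fun j : 'I_N => angle N j)).
set S := \sum_(j < N) G j.
(* Only the frequencies with q = p + 1 or p = q + 1 survive. Each family has total sign -(M - 1), so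
   the cosine part is -(M - 1) S and leaves S. *)
transitivity (M%:R * S + \sum_(p < M) \sum_(q < M)
   ((-1) ^+ p * (-1) ^+ q * (q == p.+1 :> nat)%:R +
   (-1) ^+ q * (-1) ^+ p * (p == q.+1 :> nat)%:R) * (S / 2)).
  congr (_ + _); apply: eq_bigr => p _; apply: eq_bigr => q _.
  have -> : d%:Z + (p%:Z - q%:Z) * d%:Z = (1 + p%:Z - q%:Z) * d%:Z by ring.
  have -> : d%:Z - (p%:Z - q%:Z) * d%:Z = (1 + q%:Z - p%:Z) * d%:Z by ring.
  rewrite !sum_cos_cons; try
    by have := ltn_ord p; have := ltn_ord q; lia.
  rewrite !subr_eq0 [1 + p%:Z == _]eq_sym [1 + q%:Z == _]eq_sym.
  rewrite (_ : (q%:Z == 1 + p%:Z) = (q == p.+1 :> nat))//.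
  rewrite (_ : (p%:Z == 1 + q%:Z) = (p == q.+1 :> nat))//.
  by rewrite -/S; field.
have E := sum_sign_offdiag M.-1; rewrite prednK// in E.
under eq_bigr => p _ do rewrite -mulr_suml big_split.
rewrite -mulr_suml big_split /= E exchange_big E /=.
by rewrite -subn1 natrB//; field.
Qed.

End Cons.

Lemma sum_prod_fejer N M s : uniq s -> relation_free_mod N M s ->
  \sum_(j < N) \prod_(d <- s) fejer M (d%:R * angle N j) =
  M%:R ^+ size s * N%:R.
Proof.
elim: s => [|d s IH] us fr /=.
  under eq_bigr => j _ do rewrite big_nil.
  by rewrite sumr_const card_ord mul1r.
under eq_bigr => j _ do rewrite big_cons.
rewrite sum_fejer_cons// IH ?exprS ?mulrA//; first by have /andP[] := us.
exact: relation_free_mod_cons _ _ _ _ us fr.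
Qed.

Lemma exists_angle N M s delta : (0 < N)%N -> (0 < M)%N -> uniq s ->
  relation_free_mod N M s -> (size s)%:R < delta * M%:R ->
  exists j : 'I_N,
    {in s, forall d, 1 + cos (d%:R * angle N j) < delta}.
Proof.
move=> N0 M0 us fr sM.
pose F (j : 'I_N) := \prod_(d <- s) fejer M (d%:R * angle N j).
pose T (j : 'I_N) := \sum_(d <- s) (1 + cos (d%:R * angle N j)).
have F0 j : 0 <= F j by apply: prodr_ge0 => d _; exact: fejer_ge0.
have SF : 0 < \sum_j F j.
  by rewrite sum_prod_fejer// mulr_gt0 ?exprn_gt0 ?ltr0n.
have ST : M%:R * \sum_j T j * F j = (size s)%:R * \sum_j F j.
  under eq_bigr => j _ do rewrite mulr_suml.
  rewrite exchange_big /= mulr_sumr.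
  rewrite (eq_big_seq (fun=> \sum_j F j)) => [|d ds].
    by rewrite big_const_seq count_predT iter_addr_0 mulr_natl.
  (* Moving [d] to the front makes its kernel the factor singled out in the two weighted sums
     above. *)
  have ps := perm_to_rem ds.
  have us' : uniq (d :: rem d s) by rewrite -(perm_uniq ps).
  have fr' := relation_free_mod_perm _ _ _ _ ps fr.
  transitivity (M%:R * \sum_(j < N) \prod_(e <- rem d s)
      fejer M (e%:R * angle N j)).
    congr (_ * _); rewrite -[RHS](sum_cos_fejer_cons _ _ _ _ us' fr')//.
    by apply: eq_bigr => j _; rewrite /F (perm_big _ ps) big_cons.
  rewrite -(sum_fejer_cons _ _ _ _ us' fr').
  by apply: eq_bigr => j _; rewrite /F (perm_big _ ps) big_cons.
have [j Tj] : exists j, T j < delta.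
  apply: contrapT => /forallNP H.
  have : delta * \sum_j F j <= \sum_j T j * F j.
    rewrite mulr_sumr; apply: ler_sum => j _; rewrite ler_wpM2r//.
    by rewrite leNgt; apply/negP; exact: H.
  rewrite -(ler_pM2l (x := M%:R)) ?ltr0n// ST mulrA ler_pM2r// => H'.
  by move: sM; rewrite ltNge mulrC H'.
exists j => d ds; apply: le_lt_trans Tj.
rewrite /T (perm_big _ (perm_to_rem ds)) big_cons lerDl.
apply: sumr_ge0 => e _; have := cos_geN1 (e%:R * angle N j); lra.
Qed.

End Fejer.

(** * From integer relations to relations modulo N *)

Definition relation_free M (s : seq nat) :=
  forall a : nat -> int, (forall d, `|a d| <= M%:Z) ->
  \sum_(d <- s) a d * d%:Z = 0 -> {in s, forall d, a d = 0}.

(** The modulus exceeds every |sum a_d d| with |a_d| <= M, so divisibility forces the sum to be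
    0. *)
Lemma relation_free_modW M s : relation_free M s ->
  relation_free_mod (M * \sum_(d <- s) d).+1 M s.
Proof.
move=> fr a aM Na; apply: fr => //.
set S := \sum_(d <- s) a d * d%:Z.
have SM : `|S| <= (M * \sum_(d <- s) d)%:Z.
  apply: le_trans (ler_norm_sum _ _ _) _.
  rewrite big_distrr /= (big_morph Posz PoszD (erefl _)) ler_sum// => d _.
  by rewrite normrM PoszM ler_wpM2r.
move: Na; rewrite -/S /dvdz /= => NS.
have [S0|S0] := posnP `|S|%N; first by apply/eqP; rewrite -absz_eq0 S0.
by have := dvdn_leq S0 NS; rewrite -ltz_nat in S0 *; lia.
Qed.

(** * Counting the sets that satisfy a relation *)

Definition coefs M : seq int := [seq i%:Z - M%:Z | i <- iota 0 M.*2.+1].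

(** Repetitions are kept, so that the length depends only on [M] and the size of [s]. *)
Fixpoint combos M (s : seq nat) : seq int :=
  if s is d :: s' then [seq r * d%:Z + v | r <- coefs M, v <- combos M s']
  else [:: 0].

Lemma size_combos M s : size (combos M s) = (M.*2.+1 ^ size s)%N.
Proof.
elim: s => [//|d s IH].
transitivity (size (coefs M) * size (combos M s))%N; first exact: size_allpairs.
by rewrite IH size_map size_iota -expnS.
Qed.

Lemma mem_combos M (a : nat -> int) s : (forall d, `|a d| <= M%:Z) ->
  \sum_(d <- s) a d * d%:Z \in combos M s.
Proof.
move=> aM; elim: s => [|d s IH]; first by rewrite big_nil mem_head.
rewrite big_cons; apply: (allpairs_f (fun r v => r * d%:Z + v)) => //.
have := aM d; move: (a d) => r rM.
apply/mapP; exists (absz (r + M%:Z)); last by lia.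
by rewrite mem_iota; lia.
Qed.

(* If [c * d = - v] with [0 < c <= M] and [v \in combos M s], then [d] is listed. *)
Definition completions M (s : seq nat) : seq nat :=
  [seq (`|v| %/ c)%N | v <- combos M s, c <- iota 1 M].

Lemma size_completions M s :
  size (completions M s) = (M.*2.+1 ^ size s * M)%N.
Proof. by rewrite size_allpairs size_combos size_iota. Qed.

Lemma completionsP M (D : {fset nat}) : ~ relation_free M D ->
  exists2 d, d \in D & d \in completions M (D `\ d)%fset.
Proof.
move=> /existsNP[a] /not_implyP[aM] /not_implyP[a0].
move=> /existsNP[d] /not_implyP[dD /eqP ad]; exists d => //.
have rM := aM d.
apply/allpairsP; exists (\sum_(e <- (D `\ d)%fset) a e * e%:Z, `|a d|%N).
split => /=; first exact: mem_combos.
  by rewrite mem_iota; lia.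
move: a0; rewrite (big_fsetD1 d)//= => /eqP; rewrite addrC addr_eq0 => /eqP ->.
by rewrite abszN abszM mulKn// lt0n absz_eq0.
Qed.

(** The shift i -> i + 1 carries the k-subsets of ['I_n], counted by [card_draws], onto
    [ksubsets n k]. *)
Lemma card_ksubsets n k : #|` ksubsets n k| = 'C(n, k).
Proof.
pose g (A : {set 'I_n}) : {fset nat} :=
  [fset x in [seq (val i).+1 | i <- enum A]]%fset.
have inj : injective (fun i : 'I_n => (val i).+1) by move=> i j [] /val_inj.
have gE (A : {set 'I_n}) (i : 'I_n) : (i \in A) = (i.+1 \in g A).
  by rewrite inE (mem_map inj) mem_enum.
rewrite -[in RHS](card_ord n) -card_draws cardE -(size_map g).
apply/perm_size/uniq_perm.
- exact: fset_uniq.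
- rewrite map_inj_uniq ?enum_uniq// => A B AB.
  by apply/setP => i; rewrite !gE AB.
have cardg A : #|` g A| = #|A|.
  by rewrite card_fseq undup_id ?size_map -?cardE// map_inj_uniq ?enum_uniq.
move=> D; rewrite !inE fpowersetE.
apply/andP/mapP => [[/fsubsetP Dn Dk]|[A]].
  have gD : g (finset (fun i : 'I_n => i.+1 \in D)) = D.
    apply/fsetP => d; rewrite inE; apply/mapP/idP => [[i]|dD].
      by rewrite mem_enum inE => iD ->.
    have := Dn d dD; rewrite inE mem_iota => /andP[d0 dn].
    have dn' : (d.-1 < n)%N by lia.
    by exists (Ordinal dn'); rewrite ?mem_enum ?inE /= prednK.
  exists (finset (fun i : 'I_n => i.+1 \in D)); last by rewrite gD.
  by rewrite mem_enum inE -cardg gD.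
rewrite mem_enum inE => /eqP Ak ->; split; last by rewrite cardg Ak.
apply/fsubsetP => d; rewrite !inE => /mapP[i _ ->].
by rewrite mem_iota /=; have := ltn_ord i; lia.
Qed.

(** Such a [D] is recovered from E = D \ d and the position of [d] in [completions M E], whose
    length is the same for all [E] of size [k]. *)
Lemma card_not_relation_free M n k :
  (#|` [fset D in ksubsets n k.+1 | ~~ `[< relation_free M D >]]%fset| <=
   'C(n, k) * (M.*2.+1 ^ k * M))%N.
Proof.
rewrite -card_ksubsets -(size_iota 0 (M.*2.+1 ^ k * M)).
rewrite -(size_allpairs
  (fun (E : {fset nat}) i => nth 0%N (completions M E) i |` E)%fset).
apply: uniq_leq_size; first exact: fset_uniq.
move=> D; rewrite !inE fpowersetE /= => /andP[/andP[Dn /eqP Dk]].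
move=> /asboolPn /completionsP[d dD].
set E := (D `\ d)%fset => dE.
have Ek : #|` E| = k by have := cardfsD1 d D; rewrite dD Dk => -[].
apply/allpairsP; exists (E, index d (completions M E)); split => /=.
- rewrite !inE fpowersetE Ek eqxx andbT.
  exact: fsubset_trans (fsubD1set _ _) Dn.
- by rewrite mem_iota /= -Ek -size_completions index_mem.
- by rewrite nth_index// fsetD1K.
Qed.

(** * From angles close to pi to a lower bound on kappa *)

Section Kappa.
Variable R : realType.

Lemma cos_pi2_lt1 (eps : R) : 0 < eps <= 2^-1 -> cos (pi *+ 2 * eps) < 1.
Proof.
move=> /andP[e0 e1]; have p0 := pi_gt0 R.
by rewrite -(cos0 R) ltr_cos ?in_itv /= ?lexx; nra.
Qed.

(** An integer m with |x - m| < 1/2 - eps would put 2 pi |x - m| below pi - 2 pi eps, in the range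
    where cosine decreases, contradicting the bound on cos (2 pi x). *)
Lemma dist_int_ge (x eps : R) : 0 < eps <= 2^-1 ->
  cos (pi *+ 2 * x) < - cos (pi *+ 2 * eps) -> 2^-1 - eps <= dist_int x.
Proof.
move=> /andP[e0 e1] cx; have p0 := pi_gt0 R.
apply: lb_le_inf; first by exists `|x - 0%:~R|, 0.
move=> _ [m _ <-]; rewrite leNgt; apply/negP => ym.
have y0 := normr_ge0 (x - m%:~R).
have : cos (pi - pi *+ 2 * eps) < cos (pi *+ 2 * `|x - m%:~R|).
  by rewrite ltr_cos ?in_itv /=; nra.
have -> : pi *+ 2 * `|x - m%:~R| = `|pi *+ 2 * (x - m%:~R)|.
  by rewrite normrM gtr0_norm//; lra.
have -> : cos `|pi *+ 2 * (x - m%:~R)| = cos (pi *+ 2 * x).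
  rewrite cos_norm -[RHS](cosDint2pi _ _ (- m)); congr cos.
  by rewrite intrN; ring.
rewrite cosB cospi sinpi; lra.
Qed.

Lemma kappa_ge (D : {fset nat}) M (eps : R) : 0 < eps <= 2^-1 ->
  relation_free M D -> #|` D|%:R < (1 - cos (pi *+ 2 * eps)) * M%:R ->
  2^-1 - eps <= kappa R D.
Proof.
move=> e01 fr DM.
have M0 : (0 < M)%N.
  by rewrite lt0n; apply: contraTN DM => /eqP ->; rewrite mulr0 ltrn0.
have [j jP] := exists_angle R _ _ _ _ (ltn0Sn _) M0 (fset_uniq D)
  (relation_free_modW _ _ fr) DM.
set N := (M * \sum_(d <- D) d)%N in j jP *.
apply: (@le_trans _ _ (min_dist D (j%:R / N.+1%:R : R))).
  (* The neutral element 1/2 of the minimum must satisfy the bound as well. *)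
  rewrite /min_dist big_seq; apply: le_bigmin => [|d dD].
    by have /andP[] := e01; lra.
  apply: dist_int_ge => //; have := jP d dD; rewrite /angle.
  have -> : d%:R * (pi *+ 2 * (j%:R / N.+1%:R)) =
            pi *+ 2 * (j%:R / N.+1%:R * d%:R) :> R by ring.
  lra.
apply: ub_le_sup.
  by exists 2^-1 => _ [x _ <-]; exact: bigmin_le_id.
exists (j%:R / N.+1%:R) => //=.
by rewrite in_itv /= divr_ge0//= ltr_pdivrMr ?ltr0n// mul1r ltr_nat ltn_ord.
Qed.

End Kappa.

(** * The probability estimate and its limit *)

Lemma unif_prob_ge (R : realType) (T : choiceType) (S : {fset T})
    (P Q : T -> Prop) : (0 < #|` S|)%N ->
  {in S, forall s, Q s -> P s} ->
  1 - #|` [fset s in S | ~~ `[< Q s >]]%fset|%:R / #|` S|%:R <=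
  unif_prob R S P <= 1.
Proof.
move=> S0 QP; have S0R : (0 : R) < #|` S|%:R by rewrite ltr0n.
rewrite /unif_prob; apply/andP; split; last first.
  rewrite ler_pdivrMr// mul1r ler_nat; apply: fsubset_leq_card.
  by apply/fsubsetP => s; rewrite !inE => /andP[].
rewrite lerBlDr -mulrDl ler_pdivlMr// mul1r -natrD ler_nat.
apply: leq_trans (leq_card_fsetU _ _).1.
apply/fsubset_leq_card/fsubsetP => s sS; rewrite !inE sS /=.
have [q|nq] := asboolP (Q s); last by rewrite orbT.
by rewrite asboolT//; exact: QP.
Qed.

Theorem theorem1 (R : realType) (k : nat) (eps : R) :
  (0 < k)%N -> 0 < eps ->
  (fun n : nat =>
     unif_prob R (ksubsets n k)
       (fun D : {fset nat} => 2^-1 - eps <= kappa R D)) @ \oo --> (1 : R).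
Proof.
case: k => // k _ eps0.
(* Capping at 1/2 keeps 2 pi e within [0, pi]; a smaller [e] gives a stronger bound on kappa. *)
pose e := Num.min eps 2^-1.
have e01 : 0 < e <= 2^-1 by rewrite lt_min eps0 invr_gt0 ltr0n ge_min lexx orbT.
pose delta := 1 - cos (pi *+ 2 * e).
have delta0 : 0 < delta by rewrite subr_gt0 cos_pi2_lt1.
pose M := Num.bound (k.+1%:R / delta).
have kM : k.+1%:R < delta * M%:R.
  by rewrite mulrC -ltr_pdivrMr// archi_boundP// divr_ge0// ltW.
pose K := (M.*2.+1 ^ k * M)%N.
(* The bad fraction is at most K C(n,k) / C(n,k+1) = K (k + 1) / (n - k). For n >= 2 (k + 1) one has
   n + 1 <= 2 (n - k), hence the factor 2 against [harmonic n], which is 1 / (n + 1). *)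
pose C : R := (2 * k.+1 * K)%:R.
apply: (@squeeze_cvgr _ _ _ _ (fun n => 1 - C * harmonic n) (fun=> 1)).
- near=> n.
  have nk : (2 * k.+1 <= n)%N by near: n; exact: nbhs_infty_ge.
  have T0 : (0 < #|` ksubsets n k.+1|)%N by rewrite card_ksubsets bin_gt0; lia.
  have QP : {in ksubsets n k.+1, forall D : {fset nat}, relation_free M D ->
      2^-1 - eps <= kappa R D}.
    move=> D; rewrite !inE => /andP[_ /eqP Dk] fr.
    apply: le_trans (kappa_ge R _ _ _ e01 fr _); last by rewrite Dk.
    by rewrite lerD2l lerN2 ge_min lexx.
  have /andP[lo ->] := @unif_prob_ge R _ _ _ _ T0 QP.
  rewrite andbT; apply: le_trans lo; rewrite lerD2l lerN2.
  rewrite ler_pdivrMr ?ltr0n// /harmonic /= mulrAC ler_pdivlMr ?ltr0n//.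
  rewrite -!natrM ler_nat.
  apply: leq_trans (leq_mul (card_not_relation_free _ _ _) (leqnn _)) _.
  rewrite card_ksubsets -/K.
  have := mul_bin_left n k => binE.
  have -> : (2 * k.+1 * K * 'C(n, k.+1) = 'C(n, k) * K * (2 * (n - k)))%N.
    transitivity (2 * K * (k.+1 * 'C(n, k.+1)))%N; first by ring.
    by rewrite binE; ring.
  by rewrite leq_mul2l; apply/orP; right; lia.
- rewrite -[X in _ --> X]subr0 -[X in _ - X](mulr0 C).
  by apply: cvgB; [exact: cvg_cst | apply: cvgMl_tmp; exact: cvg_harmonic].
- exact: cvg_cst.
Unshelve. all: by end_near.
Qed.
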